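(* Let $k \ge 2$ be an integer and $q \ge 7$ a prime power, both fixed, such that $\mathrm{char}(\mathbb F_q) \nmid (k+1)$. If $n \ge k+1$ and $F$ is a monic polynomial in $\mathbb F_q[x]$ of degree $n$, then the interval $\mathcal I_q(F,h)$ contains a $k$-free polynomial for every integer $h \ge n/(k+2)$. Moreover, the same conclusion holds when $k \ge 3$ and $q \ge 5$ (with $\mathrm{char}(\mathbb F_q) \nmid (k+1)$).
   Context: $\mathbb F_q$ denotes the finite field with $q$ elements. For $F \in \mathbb F_q[x]$ and an integer $h$, $\mathcal I_q(F,h) = \{ Q \in \mathbb F_q[x] : \deg(F-Q) \le h\}$. A polynomial in $\mathbb F_q[x]$ is $k$-free if it is not divisible by the $k$th power of any non-constant polynomial. *)

(* Defs.v *)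
From HB Require Import structures.
From mathcomp Require Import all_boot all_order all_algebra.

Set Implicit Arguments.
Unset Strict Implicit.
Unset Printing Implicit Defensive.

Import Order.TTheory GRing.Theory Num.Theory.
Local Open Scope ring_scope.

(* The zero polynomial has degree -oo, hence degree <= h for every h. *)
Definition deg_le (R : nzRingType) (p : {poly R}) (h : int) : bool :=
  (p == 0) || ((size p).-1%:Z <= h).

Definition interval_q (R : nzRingType) (F : {poly R}) (h : int) :
    pred {poly R} :=
  [pred Q : {poly R} | deg_le (F - Q) h].

Definition kfree (K : fieldType) (k : nat) (Q : {poly K}) : Prop :=
  forall P : {poly K}, (1 < size P)%N -> ~~ (P ^+ k %| Q).

(* Main.v *)
Require Import Defs.
From HB Require Import structures.
From mathcomp Require Import all_boot all_order all_algebra all_field.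
From mathcomp Require Import zify ring.

Set Implicit Arguments.
Unset Strict Implicit.
Unset Printing Implicit Defensive.

Import Order.TTheory GRing.Theory Num.Theory.
Local Open Scope ring_scope.

(** Union bound over the monic irreducible [P]: a polynomial [F + g], with
    [deg g <= h], fails to be [k]-free exactly when some [P ^+ k] divides it.
    The [P] of degree at most [h] are disposed of trivially.  For degree
    [d > h >= n / (k + 2)] each [P] kills at most one [g], so one bounds the
    number of [P] of degree [d] having a multiple [m P^k] in the interval.

    If [m1 P^k] and [m2 R^k] both lie in the interval and [P - R] has degree less
    than [((k + 2) d - n) / 3], the Pade approximant of [z ^ k] at [z = 1] forces
    [m1 ((k+1) P - (k-1) R) = m2 ((k+1) R - (k-1) P)].  When the characteristic
    does not divide [k], three such [P] lead to a contradiction, so every ball of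
    that radius contains at most two.  When it divides [k], the first-order
    approximation already gives [m1 = m2] on larger balls, and then
    [P^k - R^k] is a [p]-power of large degree unless [P] and [R] are very
    close. *)

(** * Identities for the Pade approximant of a power *)

(* That is [(k + 1) x - (k - 1) y]; [pade k x y / pade k y x] is the [1/1] Pade
   approximant of [(x / y) ^ k] at [x = y]. *)
Definition pade (R : pzRingType) (k : nat) (x y : R) : R :=
  k%:R * (x - y) + (x + y).

(** Expanding the summands leaves mixed sums that the factor [x - y] telescopes to [x^k - y^k]. Each
    summand is divisible by [(x - y)^2], so the right side vanishes to order 3 at [x = y]; this is
    the source of the 3 in the degree bounds below. *)
Lemma pade_remainder (R : comPzRingType) (k : nat) (x y : R) :
  pade k x y * y ^+ k - pade k y x * x ^+ k =
  (x - y) * \sum_(i < k) (x ^+ i.+1 - y ^+ i.+1) *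
                         (x ^+ (k.-1 - i) - y ^+ (k.-1 - i)).
Proof.
have hsum : \sum_(i < k) (x ^+ i.+1 - y ^+ i.+1) *
                         (x ^+ (k.-1 - i) - y ^+ (k.-1 - i)) =
    k%:R * (x ^+ k + y ^+ k) - x * (\sum_(i < k) y ^+ (k.-1 - i) * x ^+ i)
      - y * (\sum_(i < k) x ^+ (k.-1 - i) * y ^+ i).
  rewrite !mulr_sumr mulr_natl -[k in _ *+ k]card_ord -sumr_const -!sumrB.
  apply: eq_bigr => i _.
  have hk : k = (i.+1 + (k.-1 - i))%N by have := ltn_ord i; lia.
  by rewrite [in X in _ = X - _ - _]hk !exprD !exprS; ring.
rewrite hsum /pade !mulrBr.
rewrite [(x - y) * (x * _)]mulrCA [(x - y) * (y * _)]mulrCA -subrXX.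
rewrite -[X in x * (X * _)]opprB mulNr -subrXX.
ring.
Qed.

(** The left side is alternating in [x, y, z] and homogeneous of degree 3, hence a constant times
    the Vandermonde product. *)
Lemma pade_cyclic (R : comPzRingType) (k : nat) (x y z : R) :
  pade k x y * pade k y z * pade k z x - pade k y x * pade k z y * pade k x z =
  (2%:R * k%:R * (k%:R + 1) * (k%:R - 1)) * ((x - y) * (y - z) * (z - x)).
Proof. rewrite /pade; ring. Qed.

(** * Degree estimates, and rigidity of nearby multiples of kth powers *)

Section Sizes.

Variable K : fieldType.
Implicit Types P Q R m : {poly K}.

Lemma size_mul_leqS P Q a b :
  (size P <= a)%N -> (size Q <= b.+1)%N -> (size (P * Q)%R <= a + b)%N.
Proof. by move=> sP sQ; apply: leq_trans (size_polyMleq _ _) _; lia. Qed.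

Lemma size_exp_leq P d j :
  (size P <= d.+1)%N -> (size (P ^+ j)%R <= (d * j).+1)%N.
Proof.
move=> sP; apply: leq_trans (size_poly_exp_leq _ _) _.
by rewrite ltnS leq_mul2r; apply/orP; right; lia.
Qed.

Lemma size_sum_expM_leq P R d j :
    (size P <= d.+1)%N -> (size R <= d.+1)%N ->
  (size (\sum_(i < j) P ^+ (j.-1 - i) * R ^+ i)%R <= (d * j.-1).+1)%N.
Proof.
move=> sP sR; apply: (leq_trans (size_sum _ _ _)); apply/bigmax_leqP => i _.
apply: leq_trans (size_polyMleq _ _) _.
have := size_exp_leq (j.-1 - i) sP; have := size_exp_leq i sR.
have -> : (d * j.-1 = d * (j.-1 - i) + d * i)%N.
  by rewrite -mulnDr subnK //; have := ltn_ord i; lia.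
lia.
Qed.

Lemma size_expB_leq P R d j :
    (size P <= d.+1)%N -> (size R <= d.+1)%N ->
  (size (P ^+ j - R ^+ j)%R <= size (P - R)%R + d * j.-1)%N.
Proof.
move=> sP sR; rewrite subrXX.
exact: size_mul_leqS (leqnn _) (size_sum_expM_leq j sP sR).
Qed.

(** In degrees the bound is [3 deg (P - R) + d (k - 2)]: three factors [P - R] are extracted, and
    [k - 2] factors of degree at most [d] remain. *)
Lemma size_pade_remainder P R d k :
    (1 < k)%N -> (size P <= d.+1)%N -> (size R <= d.+1)%N -> P != R ->
  (size (pade k P R * R ^+ k - pade k R P * P ^+ k)%R
     <= 3 * size (P - R)%R - 2 + d * (k - 2))%N.
Proof.
move=> k1 sP sR nPR; rewrite pade_remainder.
have s0 : (0 < size (P - R)%R)%N by rewrite size_poly_gt0 subr_eq0.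
have -> : (3 * size (P - R)%R - 2 + d * (k - 2) =
           size (P - R)%R + (2 * size (P - R)%R - 2 + d * (k - 2)))%N by lia.
apply: size_mul_leqS => //.
apply: (leq_trans (size_sum _ _ _)); apply/bigmax_leqP => i _.
(* The summand with exponent 0 vanishes; it is set apart because [(k.-1 - i).-1] would truncate
   there. *)
have [->|hi] := eqVneq (k.-1 - i)%N 0%N.
  by rewrite !expr0 subrr mulr0 size_poly0.
have -> : ((2 * size (P - R)%R - 2 + d * (k - 2)).+1 =
    size (P - R)%R + d * i.+1.-1 + (size (P - R)%R - 1 + d * (k.-1 - i).-1))%N.
  have -> : (d * (k - 2) = d * i.+1.-1 + d * (k.-1 - i).-1)%N.
    by rewrite -mulnDr; congr (_ * _)%N; have := ltn_ord i; lia.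
  by lia.
apply: size_mul_leqS; first exact: size_expB_leq.
by apply: leq_trans (size_expB_leq _ sP sR) _; lia.
Qed.

Lemma size_pade_leq P R d k :
  (size P <= d.+1)%N -> (size R <= d.+1)%N -> (size (pade k P R) <= d.+1)%N.
Proof.
move=> sP sR; rewrite /pade mulrC -[d.+1]addn0.
apply: leq_trans (size_polyD _ _) _; rewrite geq_max; apply/andP; split.
  apply: size_mul_leqS; last by rewrite -polyC_natr size_polyC_leq1.
  by apply: leq_trans (size_polyD _ _) _; rewrite geq_max size_polyN sP.
by apply: leq_trans (size_polyD _ _) _; rewrite addn0 geq_max sP.
Qed.

Lemma size_expE P d j : size P = d.+1 -> size (P ^+ j) = (d * j).+1.
Proof.
move=> sP; have P0 : P != 0 by rewrite -size_poly_gt0 sP.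
by rewrite -[LHS]prednK ?size_poly_gt0 ?expf_neq0 // size_exp sP.
Qed.

(** Relations between cofactors are proved through this: multiplied by [P^k R^k], they become
    statements about polynomials whose degrees are under control. *)
Lemma mul_exps_small_eq0 P R m d k :
    size P = d.+1 -> size R = d.+1 ->
    (size (m * (P ^+ k * R ^+ k))%R <= 2 * (d * k))%N ->
  m = 0.
Proof.
move=> sP sR; apply: contraTeq => m0.
have nz (S : {poly K}) : size S = d.+1 -> S ^+ k != 0.
  by move=> sS; rewrite expf_neq0 // -size_poly_gt0 sS.
rewrite !size_mul ?mulf_neq0 ?nz // (size_expE _ sP) (size_expE _ sR).
by move: m0; rewrite -size_poly_gt0; case: (size m) => // s _; lia.
Qed.

(** The last size condition says [3 deg (P - R) + n < (k + 2) d], so that [m1 P^k], of degree [n],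
    times the Pade remainder has degree below [2 d k]. *)
Lemma close_multiples_pade P R m1 m2 d k n h :
    (1 < k)%N -> (h < d)%N -> size P = d.+1 -> size R = d.+1 -> P != R ->
    size (m1 * P ^+ k) = n.+1 -> (size (m1 * P ^+ k - m2 * R ^+ k)%R <= h.+1)%N ->
    (3 * size (P - R)%R + n <= (k + 2) * d + 2)%N ->
  m1 * pade k P R = m2 * pade k R P.
Proof.
move=> k1 hd sP sR nPR sQ1 sQ hclose.
apply/eqP; rewrite -subr_eq0; apply/eqP.
apply: (mul_exps_small_eq0 (k := k) sP sR).
have -> : (m1 * pade k P R - m2 * pade k R P) * (P ^+ k * R ^+ k) =
    (m1 * P ^+ k) * (pade k P R * R ^+ k - pade k R P * P ^+ k) +
    (m1 * P ^+ k - m2 * R ^+ k) * (pade k R P * P ^+ k) by ring.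
apply: leq_trans (size_polyD _ _) _; rewrite geq_max.
have s0 : (0 < size (P - R)%R)%N by rewrite size_poly_gt0 subr_eq0.
have sT := size_pade_remainder k1 (eq_leq sP) (eq_leq sR) nPR.
have dk : (d * k = d * (k - 2) + 2 * d)%N by nia.
rewrite mulnDl [(k * d)%N]mulnC dk in hclose *.
move: (d * (k - 2))%N (size (P - R)%R) dk hclose s0 sT => e s dk hclose s0 sT.
apply/andP; split.
  have -> : (2 * (e + 2 * d) = n.+1 + (2 * (e + 2 * d) - n.+1))%N by lia.
  by apply: size_mul_leqS; [rewrite sQ1 | apply: leq_trans sT _; lia].
(* This term has degree at most [h + d + d k], below [2 d k] because [h < d] and [k >= 2]. *)
have -> : (2 * (e + 2 * d) = h.+1 + (d + d * k + (e + d - h.+1)))%N by lia.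
apply: size_mul_leqS => //; rewrite -addSn; apply: leq_trans (leq_addr _ _).
rewrite -addSn; apply: size_mul_leqS; first by apply: size_pade_leq; rewrite ?sP ?sR.
by rewrite (size_expE _ sP).
Qed.

Lemma monic_irreducible_coprimep P R :
    P \is monic -> R \is monic -> irreducible_poly P -> size P = size R ->
    P != R ->
  coprimep P R.
Proof.
move=> mP mR iP sPR; rewrite irreducible_poly_coprime //; apply: contra => dPR.
have : P %= R by rewrite -dvdp_size_eqp // sPR.
by rewrite eqp_monic.
Qed.

(* Modulo a characteristic dividing [k - 1] the relations between the cofactors
   degenerate to [m1 P1 = m2 P2 = m3 P3], so [P2 P3] divides [m1], which is too
   short; otherwise multiplying the three relations cyclically contradicts
   [pade_cyclic]. *)
Lemma no_three_close P1 P2 P3 Q1 Q2 Q3 d k n h :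
    2%:R != 0 :> K -> k%:R != 0 :> K -> k.+1%:R != 0 :> K ->
    (1 < k)%N -> (h < d)%N ->
    size P1 = d.+1 -> size P2 = d.+1 -> size P3 = d.+1 ->
    P1 \is monic -> P2 \is monic -> P3 \is monic ->
    irreducible_poly P1 -> irreducible_poly P2 ->
    size Q1 = n.+1 -> size Q2 = n.+1 -> size Q3 = n.+1 ->
    P1 ^+ k %| Q1 -> P2 ^+ k %| Q2 -> P3 ^+ k %| Q3 ->
    (size (Q1 - Q2)%R <= h.+1)%N -> (size (Q2 - Q3)%R <= h.+1)%N ->
    (size (Q3 - Q1)%R <= h.+1)%N ->
    (3 * size (P1 - P2)%R + n <= (k + 2) * d + 2)%N ->
    (3 * size (P2 - P3)%R + n <= (k + 2) * d + 2)%N ->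
    (3 * size (P3 - P1)%R + n <= (k + 2) * d + 2)%N ->
  P1 != P2 -> P2 != P3 -> P3 != P1 -> False.
Proof.
move=> c2 ck ck1 k1 hd s1 s2 s3 mo1 mo2 mo3 i1 i2 sQ1 sQ2 sQ3.
move=> /dvdpP[m1 e1] /dvdpP[m2 e2] /dvdpP[m3 e3]; subst Q1 Q2 Q3.
move=> d12 d23 d31 l12 l23 l31 n12 n23 n31.
have r12 := close_multiples_pade k1 hd s1 s2 n12 sQ1 d12 l12.
have r23 := close_multiples_pade k1 hd s2 s3 n23 sQ2 d23 l23.
have r31 := close_multiples_pade k1 hd s3 s1 n31 sQ3 d31 l31.
have natP (j : nat) : j%:R != 0 :> K -> j%:R != 0 :> {poly K}.
  by rewrite -polyC_natr polyC_eq0.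
have m0 (m P : {poly K}) : size (m * P ^+ k) = n.+1 -> m != 0.
  by move=> s; apply: contra_eq_neq s => ->; rewrite mul0r size_poly0.
have [ck0|ck0] := eqVneq (k%:R - 1 : {poly K}) 0.
  have kE : k%:R = 1 :> {poly K} by apply/eqP; rewrite -subr_eq0 ck0.
  have padeE (x y : {poly K}) : pade k x y = 2%:R * x by rewrite /pade kE; ring.
  move: r12 r31; rewrite !padeE ![_ * (2%:R * _)]mulrCA.
  move=> /(mulfI (natP _ c2)) r12 /(mulfI (natP _ c2)) r31.
  have cop21 : coprimep P2 P1.
    by apply: monic_irreducible_coprimep; rewrite ?s2 // eq_sym.
  have cop31 : coprimep P3 P1.
    rewrite coprimep_sym; apply: monic_irreducible_coprimep; rewrite ?s1 //.
    by rewrite eq_sym.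
  have cop23 : coprimep P2 P3.
    by apply: monic_irreducible_coprimep; rewrite ?s2.
  have : P2 * P3 %| m1.
    rewrite Gauss_dvdp //; apply/andP; split.
      by rewrite -(Gauss_dvdpl _ cop21) r12 dvdp_mull.
    by rewrite -(Gauss_dvdpl _ cop31) -r31 dvdp_mull.
  (* Divisibility forces [deg m1 >= 2 d], whereas [deg m1 = n - d k < 2 d] by [l12]. *)
  move/(dvdp_leq (m0 _ _ sQ1)).
  rewrite size_mul ?monic_neq0 // s2 s3.
  have P10 : P1 ^+ k != 0 by rewrite expf_neq0 // monic_neq0.
  move: (sQ1); rewrite size_mul ?(m0 _ _ sQ1) // (size_expE _ s1).
  have : (0 < size (P1 - P2)%R)%N by rewrite size_poly_gt0 subr_eq0.
  move: l12; rewrite mulnDl [(k * d)%N]mulnC.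
  by move: (d * k)%N (size (P1 - P2)%R) (size m1); clear; lia.
have : (m1 * m2 * m3) *
    ((2%:R * k%:R * (k%:R + 1) * (k%:R - 1)) *
     ((P1 - P2) * (P2 - P3) * (P3 - P1))) = 0.
  rewrite -pade_cyclic mulrBr.
  transitivity ((m1 * pade k P1 P2) * (m2 * pade k P2 P3) * (m3 * pade k P3 P1)
     - (m2 * pade k P2 P1) * (m3 * pade k P3 P2) * (m1 * pade k P1 P3)).
    by ring.
  by rewrite r12 r23 r31; ring.
apply/eqP; rewrite !mulf_neq0 ?subr_eq0 ?(m0 _ _ sQ1) ?(m0 _ _ sQ2) //.
- exact: m0 sQ3.
- exact: natP.
- exact: natP.
- by have := natP _ ck1; rewrite -natr1.
- by rewrite -subr_eq0.
Qed.


(** By Frobenius the difference is [(P^j - R^j)^a]. The cofactor of [P - R] in [P^j - R^j] is a sum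
    of [j] monic polynomials of degree [d (j - 1)], so its leading coefficient is [j], which is
    nonzero. *)
Lemma size_expB_pchar P R d a j :
    [pchar K].-nat a -> j%:R != 0 :> K -> P \is monic -> R \is monic ->
    size P = d.+1 -> size R = d.+1 -> P != R ->
  size (P ^+ (j * a) - R ^+ (j * a)) =
    (((size (P - R)%R).-1 + d * j.-1) * a).+1.
Proof.
move=> charKa j0 monP monR sP sR nPR.
have frobB (x y : {poly K}) : x ^+ a - y ^+ a = (x - y) ^+ a.
  apply/eqP; rewrite subr_eq -exprDn_pchar ?subrK //.
  by rewrite (eq_pnat _ (pchar_poly K)).
rewrite !exprM frobB; apply: size_expE; rewrite subrXX.
set S := \sum_(i < j) _.
have coefS : S`_(d * j.-1) = j%:R.
  rewrite coef_sum -[j in RHS]card_ord -sumr_const; apply: eq_bigr => i _.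
  have monM : P ^+ (j.-1 - i) * R ^+ i \is monic by rewrite rpredM ?rpredX.
  have sM : size (P ^+ (j.-1 - i) * R ^+ i) = (d * j.-1).+1.
    rewrite size_monicM ?rpredX ?monic_neq0 ?rpredX //.
    rewrite (size_expE _ sP) (size_expE _ sR) addnS /= addSn -mulnDr subnK //.
    by have := ltn_ord i; lia.
  by move/monicP: monM; rewrite /lead_coef sM.
have S0 : S != 0 by apply: contraNneq j0 => S0; rewrite -coefS S0 coef0.
have sS : size S = (d * j.-1).+1.
  apply/eqP; rewrite eqn_leq size_sum_expM_leq ?sP ?sR //= ltnNge.
  by apply/negP => /leq_sizeP/(_ _ (leqnn _))/eqP; rewrite coefS (negPf j0).
rewrite size_mul ?subr_eq0 // sS addnS /=.
by case: (size (P - R)) (size_poly_gt0 (P - R)) => //; rewrite subr_eq0 nPR.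
Qed.

(* Here the cofactors of [P ^+ k] and [R ^+ k] coincide, so that the difference
   is a multiple of [P ^+ k - R ^+ k]. *)
Lemma close_multiples_pchar P R Q1 Q2 d a j n h :
    [pchar K].-nat a -> j%:R != 0 :> K -> (h < d)%N ->
    P \is monic -> R \is monic -> size P = d.+1 -> size R = d.+1 -> P != R ->
    size Q1 = n.+1 -> P ^+ (j * a) %| Q1 -> R ^+ (j * a) %| Q2 ->
    (size (Q1 - Q2)%R <= h.+1)%N ->
    (n + a * size (P - R)%R < j * a * d + a * d.+1)%N ->
  (n + a * size (P - R)%R <= h + a * d.+1)%N.
Proof.
move=> charKa j0 hd monP monR sP sR nPR sQ1 /dvdpP[m1 e1] /dvdpP[m2 e2].
subst Q1 Q2 => sQ hclose.
have a0 : (0 < a)%N by case/andP: charKa.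
have j_gt0 : (0 < j)%N by case: (j) j0 => //; rewrite eqxx.
have sB := size_expB_pchar charKa j0 monP monR sP sR nPR.
have s0 : (0 < size (P - R)%R)%N by rewrite size_poly_gt0 subr_eq0.
have m10 : m1 != 0.
  by apply: contra_eq_neq sQ1 => ->; rewrite mul0r size_poly0.
have Pk0 : P ^+ (j * a) != 0 by rewrite expf_neq0 ?monic_neq0.
have sm1 := sQ1; rewrite size_mul // (size_expE _ sP) in sm1.
have [t tE] : exists t, size (P - R) = t.+1.
  by exists (size (P - R)).-1; rewrite prednK.
have [i iE] : exists i, j = i.+1 by exists j.-1; rewrite prednK.
have m12 : m1 = m2.
  apply/eqP; rewrite -subr_eq0; apply/eqP.
  apply: (mul_exps_small_eq0 (k := (j * a)%N) sP sR).
  (* [hclose] says [n + a deg (P - R) < (j + 1) a d], which keeps the last product below degree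
     [2 j a d]. *)
  have -> : (m1 - m2) * (P ^+ (j * a) * R ^+ (j * a)) =
      (m1 * P ^+ (j * a) - m2 * R ^+ (j * a)) * P ^+ (j * a)
      - (m1 * P ^+ (j * a)) * (P ^+ (j * a) - R ^+ (j * a)) by ring.
  apply: leq_trans (size_polyD _ _) _; rewrite size_polyN geq_max.
  apply/andP; split.
    apply: leq_trans (size_mul_leqS sQ (eq_leq (size_expE _ sP))) _.
    have := leq_pmulr d (_ : 0 < j * a)%N; rewrite muln_gt0 j_gt0 a0.
    by move=> /(_ isT); move: hd; clear; lia.
  apply: leq_trans (size_mul_leqS (eq_leq sQ1) (eq_leq sB)) _.
  move: hclose; rewrite tE iE /=; clear; nia.
(* The difference is now [m1 (P^k - R^k)] with [k = j a]; both factors have known degree, and the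
   total is at most [h]. *)
move: sQ; rewrite -m12 -mulrBr size_mul //; last first.
  by rewrite -size_poly_gt0 sB.
rewrite sB; move: hclose sm1; rewrite tE iE /=.
by move: (size m1) (size_poly_gt0 m1); rewrite m10; clear; nia.
Qed.

End Sizes.

(** * Counting irreducibles whose kth power divides an element of the interval *)

Section Counting.

Variable Fq : finFieldType.
Local Notation q := #|Fq|.
Implicit Types P Q M : {poly Fq}.

Lemma irreducible_factor P :
  (1 < size P)%N -> exists2 S : {poly Fq}, irreducible_poly S & S %| P.
Proof.
have [m] := ubnP (size P); elim: m P => // m IHm P sPm sP.
have [/irreducibleP irrP|] := boolP (irreducibleb P); first by exists P.
rewrite /irreducibleb sP /= negb_forall => /existsP[S].
rewrite negb_imply -ltnNge -Pdiv.Idomain.dvdpE => /andP[dSP sS].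
have sSP : (size (S : {poly Fq}) < m)%N.
  by apply: leq_ltn_trans (size_npoly S) _; rewrite -ltnS prednK // ltnW.
have [T irrT dTS] := IHm _ sSP sS.
by exists T; last exact: dvdp_trans dTS dSP.
Qed.

Lemma card_fiber_leq (T U : finType) (f : T -> U) (A : {set T}) c :
  (forall u, #|[set x in A | f x == u]| <= c)%N -> (#|A| <= #|U| * c)%N.
Proof.
move=> fib; rewrite -sum1_card (partition_big f predT) //=.
rewrite -sum_nat_const; apply: leq_sum => u _.
apply: leq_trans (fib u); rewrite -sum1_card.
by apply: eq_leq; apply: eq_bigl => x; rewrite inE.
Qed.

Lemma card_rV d : #|{: 'rV[Fq]_d}| = (q ^ d)%N.
Proof. by rewrite card_mx mul1n. Qed.

(** The fibres of this map are the balls of polynomials agreeing from [X^D] upwards. *)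
Definition top_coefs D d (v : 'rV[Fq]_d) : 'rV[Fq]_(d - D) :=
  \row_i (rVpoly v)`_(D + i).

Lemma top_coefs_eq D d (v w : 'rV[Fq]_d) :
  top_coefs D v = top_coefs D w -> (size (rVpoly v - rVpoly w)%R <= D)%N.
Proof.
move=> /rowP eqvw; apply/leq_sizeP => j Dj; rewrite coefB.
have [jd|dj] := ltnP j d; last first.
  by rewrite !nth_default ?subr0 // (leq_trans (size_poly _ _)).
have jD : (j - D < d - D)%N by lia.
by have := eqvw (Ordinal jD); rewrite !mxE /= subnKC // => ->; rewrite subrr.
Qed.

(** The members of [A] agree from [X^s] upwards, so the lowest [s] coefficients determine them. *)
Lemma card_close_leq d s (A : {set 'rV[Fq]_d}) :
    {in A &, forall v w, (size (rVpoly v - rVpoly w)%R <= s)%N} ->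
  (#|A| <= q ^ s)%N.
Proof.
move=> close; rewrite -card_rV.
pose f (v : 'rV[Fq]_d) : 'rV[Fq]_s := \row_i (rVpoly v)`_i.
apply: (@leq_card_in _ _ f) => v w Av Aw /rowP eqvw.
apply: (can_inj rVpolyK); apply/eqP; rewrite -subr_eq0 -size_poly_leq0.
apply/leq_sizeP => j _; have [js|sj] := ltnP j s; last first.
  exact: (leq_sizeP _ _ (close _ _ Av Aw)).
by have := eqvw (Ordinal js); rewrite !mxE coefB /= => ->; rewrite subrr.
Qed.

(** Two multiples of [M] agreeing from [X^e] upwards differ by a multiple of [M] of degree below
    [e], hence coincide. For [e >= N] the truncated exponent gives at most one [g]. *)
Lemma card_multiples_leq N e (F M : {poly Fq}) : size M = e.+1 ->
  (#|[set g : 'rV[Fq]_N | (M %| F + rVpoly g)%R]| <= q ^ (N - e))%N.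
Proof.
move=> sM; rewrite -card_rV; apply: (@leq_card_in _ _ (@top_coefs e N)).
move=> v w; rewrite !inE => dv dw /top_coefs_eq svw.
apply: (can_inj rVpolyK); apply/eqP; rewrite -subr_eq0.
apply: contraTT isT => nvw; have := dvdp_sub dv dw.
have -> : F + rVpoly v - (F + rVpoly w) = rVpoly v - rVpoly w by ring.
by move/(dvdp_leq nvw); rewrite sM => /leq_trans/(_ svw); rewrite ltnn.
Qed.

(** Row vectors make the monic polynomials of degree [d] a finite type, with balls given by
    [top_coefs]. *)
Definition monic_of d (v : 'rV[Fq]_d) : {poly Fq} := 'X^d + rVpoly v.

Lemma size_monic_of d (v : 'rV[Fq]_d) : size (monic_of v) = d.+1.
Proof. by rewrite size_polyDl size_polyXn // ltnS size_poly. Qed.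

Lemma monic_ofP d (v : 'rV[Fq]_d) : monic_of v \is monic.
Proof.
by rewrite monicE lead_coefDl ?lead_coefXn // size_polyXn ltnS size_poly.
Qed.

Lemma monic_ofB d (v w : 'rV[Fq]_d) :
  monic_of v - monic_of w = rVpoly v - rVpoly w.
Proof. by rewrite /monic_of; ring. Qed.

Lemma monic_of_inj d : injective (@monic_of d).
Proof. by move=> v w /addrI/(can_inj rVpolyK). Qed.

Lemma monic_of_surj d P : P \is monic -> size P = d.+1 ->
  exists v : 'rV[Fq]_d, P = monic_of v.
Proof.
move=> monP sP; exists (poly_rV (P - 'X^d)); rewrite /monic_of poly_rV_K.
  by rewrite addrC subrK.
apply/leq_sizeP => j; rewrite leq_eqVlt coefB coefXn => /predU1P[<-|dj].
  by move/monicP: monP; rewrite /lead_coef sP /= eqxx => ->; rewrite subrr.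
by rewrite nth_default ?sP // gtn_eqF // subr0.
Qed.

Variables (k n h : nat) (F : {poly Fq}).
Hypothesis k_gt1 : (1 < k)%N.
Hypothesis h_lt_n : (h < n)%N.
Hypothesis n_leq : (n <= (k + 2) * h)%N.
Hypothesis size_F : size F = n.+1.

Lemma size_shift (g : 'rV[Fq]_h.+1) : size (F + rVpoly g) = n.+1.
Proof.
rewrite size_polyDl size_F //; apply: leq_ltn_trans (size_poly _ _) _.
by rewrite ltnS.
Qed.

Lemma size_shiftB (g g' : 'rV[Fq]_h.+1) :
  (size (F + rVpoly g - (F + rVpoly g'))%R <= h.+1)%N.
Proof.
have -> : F + rVpoly g - (F + rVpoly g') = rVpoly (g - g').
  by rewrite linearB /=; ring.
exact: size_poly.
Qed.

Definition hit d : {set 'rV[Fq]_d} :=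
  [set v | irreducibleb (monic_of v) &&
           [exists g : 'rV[Fq]_h.+1, monic_of v ^+ k %| F + rVpoly g]].

Lemma hitP d (v : 'rV[Fq]_d) : v \in hit d ->
  irreducible_poly (monic_of v) /\
  exists g : 'rV[Fq]_h.+1, monic_of v ^+ k %| F + rVpoly g.
Proof. by rewrite inE => /andP[/irreducibleP ? /existsP]. Qed.

Lemma hit_degree d (v : 'rV[Fq]_d) : v \in hit d -> (d * k <= n)%N.
Proof.
case/hitP=> _ [g /dvdp_leq]; rewrite -size_poly_gt0 size_shift => /(_ isT).
by rewrite (size_expE _ (size_monic_of v)).
Qed.

(** [D] is the largest size of [P - R] that [close_multiples_pade] allows; each of the [q^(d - D)]
    balls of that radius contains at most two hits. *)
Lemma card_hit_leq d :
    2%:R != 0 :> Fq -> k%:R != 0 :> Fq -> k.+1%:R != 0 :> Fq -> (h < d)%N ->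
  (#|hit d| <= q ^ (d - ((k + 2) * d - n + 2) %/ 3) * 2)%N.
Proof.
move=> c2 ck ck1 hd; set D := (_ %/ 3)%N; rewrite -card_rV.
apply: (card_fiber_leq (f := @top_coefs D d)) => u.
rewrite leqNgt; apply/negP => /card_gt2P[x [y [z []]]].
rewrite ![_ \in [set _ in _ | _]]inE.
move=> [/andP[hx /eqP tx] /andP[hy /eqP ty] /andP[hz /eqP tz]] [nxy nyz nzx].
have n_lt : (n <= (k + 2) * d)%N.
  by apply: leq_trans n_leq _; rewrite leq_mul2l ltnW ?orbT.
have close (v w : 'rV[Fq]_d) : top_coefs D v = u -> top_coefs D w = u ->
    (3 * size (monic_of v - monic_of w)%R + n <= (k + 2) * d + 2)%N.
  move=> tv tw; have := top_coefs_eq (etrans tv (esym tw)).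
  rewrite -monic_ofB; move: (size _) n_lt; rewrite /D; clear; lia.
have [irrx [gx dx]] := hitP hx; have [irry [gy dy]] := hitP hy.
have [_ [gz dz]] := hitP hz.
have neq (v w : 'rV[Fq]_d) : v != w -> monic_of v != monic_of w.
  by rewrite (inj_eq (@monic_of_inj d)).
exact: (no_three_close c2 ck ck1 k_gt1 hd (size_monic_of _) (size_monic_of _)
  (size_monic_of _) (monic_ofP _) (monic_ofP _) (monic_ofP _) irrx irry
  (size_shift _) (size_shift _) (size_shift _) dx dy dz (size_shiftB _ _)
  (size_shiftB _ _) (size_shiftB _ _) (close _ _ tx ty) (close _ _ ty tz)
  (close _ _ tz tx) (neq _ _ nxy) (neq _ _ nyz) (neq _ _ nzx)).
Qed.

(** The first quotient [w] is chosen so that [size (P - R) <= d - w] implies the closeness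
    hypothesis of [close_multiples_pchar]. Its conclusion bounds that size by the second quotient
    [b], so each of the at most [q^w] balls contains at most [q^b] hits. *)
Lemma card_hit_pchar_leq d a j :
    [pchar Fq].-nat a -> j%:R != 0 :> Fq -> k = (j * a)%N -> (h < d)%N ->
  (#|hit d| <= q ^ ((n - k * d) %/ a + (h + a * d.+1 - n) %/ a))%N.
Proof.
move=> charFa j0 kE hd; set w := (_ %/ a)%N; set b := (_ %/ a)%N.
have a0 : (0 < a)%N by case/andP: charFa.
have q0 : (0 < q)%N by apply/card_gt0P; exists 0.
apply: (@leq_trans (q ^ (d - (d - w)) * q ^ b)); last first.
  by rewrite -expnD leq_pexp2l //; clear; lia.
rewrite -card_rV; apply: (card_fiber_leq (f := @top_coefs (d - w) d)) => u.
apply: card_close_leq => x y; rewrite ![_ \in [set _ in _ | _]]inE.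
move=> /andP[hx /eqP tx] /andP[hy /eqP ty].
have [->|nxy] := eqVneq x y; first by rewrite subrr size_poly0.
have dk := hit_degree hx.
have [_ [gx dx]] := hitP hx; have [_ [gy dy]] := hitP hy.
rewrite kE in dx dy.
have nmxy : monic_of x != monic_of y by rewrite (inj_eq (@monic_of_inj d)).
have := top_coefs_eq (etrans tx (esym ty)).
have := close_multiples_pchar charFa j0 hd (monic_ofP _) (monic_ofP _)
  (size_monic_of _) (size_monic_of _) nmxy (size_shift _) dx dy
  (size_shiftB _ _).
have : (0 < size (monic_of x - monic_of y)%R)%N.
  by rewrite size_poly_gt0 subr_eq0.
rewrite monic_ofB -kE.
move: (size _) => s s0 close sw.
have nw : (n < k * d + w.+1 * a)%N.
  have := ltn_ceil (n - k * d) a0; rewrite -/w.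
  by move: (w.+1 * a)%N dk; rewrite mulnC; clear; lia.
rewrite leq_divRL // -(leq_add2l n) [(s * a)%N]mulnC.
have hyp : (n + a * s < k * d + a * d.+1)%N.
  have : (w.+1 + s <= d.+1)%N by move: s0 sw; clear; lia.
  by move/(leq_mul (leqnn a)); move: nw; rewrite mulnDr; clear; nia.
by move: (close hyp); clear; lia.
Qed.

Lemma exists_not_hit :
    (\sum_(i < 2 * h) #|hit i.+1| * q ^ (h.+1 - i.+1 * k) < q ^ h.+1)%N ->
  exists g : 'rV[Fq]_h.+1, kfree k (F + rVpoly g).
Proof.
pose bad i (v : 'rV[Fq]_i.+1) (g : 'rV[Fq]_h.+1) :=
  irreducibleb (monic_of v) && (monic_of v ^+ k %| F + rVpoly g).
move=> hsum.
have [g gP] : exists g, forall i : 'I_(2 * h), forall v, ~~ bad i v g.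
  have [/existsP[g /forallP gP]|] := boolP [exists g,
      [forall i : 'I_(2 * h), [forall v : 'rV[Fq]_i.+1, ~~ bad i v g]]].
    by exists g => i; apply/forallP.
  (* If every [g] were bad, the pairs [(v, g)] would number at least [q^(h+1)] counted by [g], and
     at most the assumed sum counted by [v]. *)
  rewrite negb_exists => /forallP allbad; move: hsum; rewrite ltnNge => /negP[].
  rewrite -card_rV -sum1_card.
  apply: (@leq_trans (\sum_(g : 'rV[Fq]_h.+1) \sum_(i < 2 * h)
            \sum_(v : 'rV[Fq]_i.+1) bad i v g)).
    apply: leq_sum => g _; have := allbad g.
    rewrite negb_forall => /existsP[i]; rewrite negb_forall => /existsP[v].
    rewrite negbK => badv.
    by rewrite (bigD1 i) //= (bigD1 v) //= badv -!addnA leq_addr.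
  rewrite exchange_big /=; apply: leq_sum => i _.
  rewrite exchange_big /= -sum_nat_const [leqRHS]big_mkcond /=.
  apply: leq_sum => v _; case: ifP => [hv|hv].
    apply: leq_trans (card_multiples_leq h.+1 F (size_expE k (size_monic_of v))).
    rewrite -sum1_card [leqRHS]big_mkcond /=; apply: leq_sum => g _.
    rewrite inE /bad.
    by case: irreducibleb => //=; case: (_ %| _).
  apply: eq_leq; apply: big1 => g _; apply/eqP; rewrite eqb0.
  apply: contraFN hv => /andP[irrv dv]; rewrite inE irrv /=.
  by apply/existsP; exists g.
exists g => P /irreducible_factor[S irrS dSP]; apply/negP => dP.
have S0 := irredp_neq0 irrS; set T := (lead_coef S)^-1 *: S.
have lS0 : (lead_coef S)^-1 != 0 by rewrite invr_eq0 lead_coef_eq0.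
have monT : T \is monic by rewrite monicE lead_coefZ mulVf ?lead_coef_eq0.
have sT : size T = (size S).-2.+2.
  by rewrite size_scale //; case: irrS => + _; case: (size S) => [|[]].
have irrT : irreducible_poly T.
  split; first by rewrite sT.
  move=> U sU; rewrite dvdpZr // => /(irrS.2 _ sU) /eqp_trans; apply.
  by rewrite eqp_sym eqp_scale.
have dT : T ^+ k %| F + rVpoly g.
  apply: dvdp_trans dP; apply: dvdp_exp2r; apply: dvdp_trans dSP.
  by rewrite dvdpZl.
have [v Tv] := monic_of_surj monT sT.
have hv : v \in hit _.
  rewrite inE -Tv; apply/andP; split; first exact/irreducibleP.
  by apply/existsP; exists g.
(* The degrees up to [2 h] suffice: [d k <= n <= (k + 2) h <= 2 k h]. *)
have iP : ((size S).-2 < 2 * h)%N.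
  have := hit_degree hv; move: k_gt1 n_leq; clear; nia.
by have /negP[] := gP (Ordinal iP) v; rewrite /bad -Tv dT andbT; apply/irreducibleP.
Qed.

End Counting.

(** * Numerical estimates *)

Lemma geometric_sum_leq (q c h : nat) : (0 < c)%N -> (2 * c < q)%N ->
  (2 * (\sum_(i < c * h) q ^ (h.-1 - i %/ c)) <= q ^ h)%N.
Proof.
move=> c0 cq; elim: h => [|h IHh]; first by rewrite muln0 big_ord0.
(* The first block of [c] indices contributes [c q^h]; the induction step is
   [(2 c + 1) q^h <= q^(h+1)]. *)
rewrite mulnS big_split_ord /=.
rewrite (eq_bigr (fun=> q ^ h)%N) => [|i _]; last by rewrite divn_small ?subn0.
rewrite [X in (_ + X)%N](eq_bigr (fun i : 'I_(c * h) => q ^ (h.-1 - i %/ c))%N);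
  last by move=> i _; rewrite divnDl // divnn c0 add1n subnS -subn1 subnAC subn1.
rewrite sum_nat_const card_ord mulnDr mulnA expnS.
apply: leq_trans (leq_add (leqnn _) IHh) _.
by rewrite addnC -mulSn leq_mul2r cq orbT.
Qed.

Lemma sum_expS (q h : nat) : (0 < q)%N ->
  ((q - 1) * (\sum_(i < h) q ^ i.+1) + q = q ^ h.+1)%N.
Proof.
move=> q0; elim: h => [|h IHh]; first by rewrite big_ord0 muln0.
rewrite big_ord_recr /= mulnDr addnAC IHh -[X in (X + _)%N]mul1n -mulnDl.
by rewrite subnKC // -expnS.
Qed.

Lemma leq_mul_exp_half (q h : nat) : (4 < q)%N -> (2 < h)%N ->
  (h * q ^ (1 + h %/ 2) <= q ^ h)%N.
Proof.
move=> q5 h3; have hE : (h = (1 + h %/ 2) + (h.-1) %/ 2)%N by lia.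
rewrite [in leqRHS]hE [leqRHS]expnD mulnC leq_mul2l; apply/orP; right.
(* With [j = (h - 1) / 2] rounded down, [h <= 2 j + 2 <= 5^j]; the second inequality starts at
   [j = 1], that is at [h = 3]. *)
apply: (@leq_trans (2 * (h.-1 %/ 2) + 2)); first lia.
apply: (@leq_trans (5 ^ (h.-1 %/ 2))); last by rewrite leq_exp2r //; lia.
have : (0 < h.-1 %/ 2)%N by lia.
elim: (h.-1 %/ 2)%N => // -[_ _|j IHj _]; first by [].
by rewrite expnS; have := IHj isT; lia.
Qed.

(** * Summing over degrees and choosing the case by the characteristic *)

Section ShortIntervals.

Variables (Fq : finFieldType) (k n h : nat) (F : {poly Fq}).
Local Notation q := #|Fq|.
Hypothesis k_gt1 : (1 < k)%N.
Hypothesis h_lt_n : (h < n)%N.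
Hypothesis n_leq : (n <= (k + 2) * h)%N.
Hypothesis size_F : size F = n.+1.
Hypothesis q_geq : ((7 <= q) || ((2 < k) && (5 <= q)))%N.

Let q_gt4 : (4 < q)%N.
Proof. by case/orP: q_geq => [|/andP[_]]; lia. Qed.

Let q_gt0 : (0 < q)%N.
Proof. exact: leq_trans q_gt4. Qed.

(** The exponent in [card_hit_leq] drops by at least one every [c] degrees, with [c = 3] for [k = 2]
    and [c = 2] for [k >= 3]. The geometric sum then requires [2 c < q], which gives the thresholds
    7 and 5. *)
Lemma sum_hit_leq :
    2%:R != 0 :> Fq -> k%:R != 0 :> Fq -> k.+1%:R != 0 :> Fq ->
  (\sum_(i < h) #|hit k h F (h + i).+1| <= 2 * q ^ h)%N.
Proof.
move=> c2 ck ck1; pose c := if (k == 2)%N then 3%N else 2%N.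
have cq : (2 * c < q)%N.
  by rewrite /c; case: eqP q_geq => [->|_] /orP[|/andP[]] //; lia.
have c0 : (0 < c)%N by rewrite /c; case: ifP.
have hc : (h <= c * h)%N by rewrite leq_pmull.
apply: (@leq_trans (2 * (\sum_(i < c * h) q ^ (h.-1 - i %/ c)))); last first.
  by apply: leq_trans (geometric_sum_leq h c0 cq) _; rewrite leq_pmull.
rewrite (big_ord_widen_cond _ predT (fun i => #|hit k h F (h + i).+1|) hc) /=.
rewrite big_distrr big_mkcond /=; apply: leq_sum => -[i /= _] _; case: ifP => // ih.
apply: leq_trans (card_hit_leq k_gt1 h_lt_n n_leq size_F c2 ck ck1 _) _.
  by rewrite ltnS leq_addr.
rewrite mulnC leq_mul2l leq_pexp2l //.
(* The radius must be at least [i + 2 + i / c]. It is at least [(4 i + 6) / 3] for [k = 2] and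
   [(5 i + 7) / 3] otherwise, rounded down. *)
have : ((k + 2) * i.+1 <= (k + 2) * (h + i).+1 - n)%N.
  by rewrite -addnS mulnDr; move: n_leq; clear; lia.
move: ((k + 2) * (h + i).+1 - n)%N => m.
rewrite /c; case: eqP => [->|k2] hm; first by move: hm ih; clear; lia.
have : (5 * i.+1 <= m)%N.
  by apply: leq_trans hm; rewrite leq_mul2r; move: k_gt1 k2; clear; lia.
by move: ih; clear; lia.
Qed.

Lemma sum_hit_pchar_leq a j :
    [pchar Fq].-nat a -> j%:R != 0 :> Fq -> k = (j * a)%N -> (1 < a)%N ->
  (\sum_(i < h) #|hit k h F (h + i).+1| <= 2 * q ^ h)%N.
Proof.
move=> charFa j0 kE a1.
have j_gt0 : (0 < j)%N by case: (j) j0 => //; rewrite eqxx.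
have ak : (a <= k)%N by rewrite kE leq_pmull.
have term (i : 'I_h) : exists2 e, (#|hit k h F (h + i).+1| <= q ^ e)%N &
    (e <= h.-1 - i)%N \/ (e <= 1 + h %/ 2)%N.
  have hd : (h < (h + i).+1)%N by rewrite ltnS leq_addr.
  have [hit0|[v hv]] := set_0Vmem (hit k h F (h + i).+1).
    by exists 0%N; [rewrite hit0 cards0 | left].
  have := card_hit_pchar_leq h_lt_n size_F charFa j0 kE hd.
  set w := (_ %/ a)%N; set b := (_ %/ a)%N => hle.
  exists (w + b)%N => //.
  have dk := hit_degree h_lt_n size_F hv.
  have aw : (w * a <= n - k * (h + i).+1)%N by apply: leq_trunc_div.
  have ab : (b * a <= h + a * (h + i).+2 - n)%N by apply: leq_trunc_div.
  (* If [b = 0], then [2 w <= n - k d <= 2 h - 2 (i + 1)]. If [b > 0], neither subtraction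
     truncates, and adding [aw] and [ab] gives [(w + b) a <= h + a] since [a <= k]. *)
  have [b0|b0] := posnP b; [left|right].
    have : (w * 2 <= 2 * h - 2 * i.+1)%N.
      apply: (@leq_trans (w * a)); first by rewrite leq_mul2l a1 orbT.
      apply: leq_trans aw _.
      have -> : (k * (h + i).+1 = k * h + k * i.+1)%N by rewrite -addnS mulnDr.
      have : (2 * i.+1 <= k * i.+1)%N by rewrite leq_mul2r k_gt1 orbT.
      by move: n_leq; rewrite mulnDl; clear; lia.
    by rewrite b0 addn0; have := ltn_ord i; clear; lia.
  have ad : (a * (h + i).+1 <= k * (h + i).+1)%N by rewrite leq_mul2r ak orbT.
  have : ((w + b).-1 * a <= h)%N.
    have -> : ((w + b).-1 = w + b.-1)%N by move: b0; clear; lia.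
    have bE : (b * a = b.-1 * a + a)%N by rewrite -{1}(prednK b0) mulSn addnC.
    rewrite mulnDl; rewrite bE mulnS in ab; rewrite mulnC in dk.
    move: aw ab ad dk; move: (k * _)%N (a * _)%N (b.-1 * a)%N (w * a)%N.
    by move: a1; clear; lia.
  move=> hh; have : ((w + b).-1 * 2 <= h)%N.
    by apply: leq_trans hh; rewrite leq_mul2l a1 orbT.
  by clear; lia.
(* For [h <= 2] both exponents are at most [h] and there are at most two terms. *)
have [h2|h3] := leqP h 2.
  apply: (@leq_trans (\sum_(i < h) q ^ h)); last first.
    by rewrite sum_nat_const card_ord leq_mul2r h2 orbT.
  apply: leq_sum => i _; have [e hle he] := term i; apply: leq_trans hle _.
  rewrite leq_pexp2l //.
  by have := ltn_ord i; move: he h2; clear; lia.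
apply: (@leq_trans (\sum_(i < h) (q ^ (h.-1 - i) + q ^ (1 + h %/ 2)))).
  apply: leq_sum => i _; have [e hle he] := term i; apply: leq_trans hle _.
  case: he => he; [apply: leq_trans (leq_addr _ _) | apply: leq_trans (leq_addl _ _)];
    exact: leq_pexp2l.
rewrite big_split /= sum_nat_const card_ord mul2n -addnn; apply: leq_add.
  apply: leq_trans (geometric_sum_leq h (ltn0Sn 0) (ltnW (ltnW q_gt4))).
  rewrite mul1n; apply: leq_trans (leq_pmull _ _) => //.
  by apply: leq_sum => i _; rewrite divn1.
exact: leq_mul_exp_half.
Qed.

Lemma sum_hit_lt :
    (\sum_(i < h) #|hit k h F (h + i).+1| <= 2 * q ^ h)%N ->
  (\sum_(i < 2 * h) #|hit k h F i.+1| * q ^ (h.+1 - i.+1 * k) < q ^ h.+1)%N.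
Proof.
move=> tail.
rewrite mul2n -addnn big_split_ord /=.
set G := (\sum_(i < h) q ^ i.+1)%N.
(* In degree [d <= h] all [q^d] monic polynomials are allowed. The term is at most [q^(h+1-d)] when
   [d k <= h + 1], and at most [q^d] otherwise; reversing the order turns the first family into
   [G]. *)
have headG : (\sum_(i < h) #|hit k h F i.+1| * q ^ (h.+1 - i.+1 * k) <= G + G)%N.
  rewrite [X in (_ <= X + _)%N](reindex_inj rev_ord_inj) -big_split /=.
  apply: leq_sum => i _; rewrite subnSK //.
  apply: (@leq_trans (q ^ i.+1 * q ^ (h.+1 - i.+1 * k))).
    by rewrite leq_mul2r -card_rV max_card orbT.
  rewrite -expnD; have ik : (i.+1 * 2 <= i.+1 * k)%N by rewrite leq_mul2l k_gt1 orbT.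
  have [hk|hk] := leqP (i.+1 * k) h.+1.
    by apply: leq_trans (leq_addr _ _); apply: leq_pexp2l => //; lia.
  by apply: leq_trans (leq_addl _ _); apply: leq_pexp2l => //; lia.
have tailE : (\sum_(i < h) #|hit k h F (h + i).+1| * q ^ (h.+1 - (h + i).+1 * k) =
    \sum_(i < h) #|hit k h F (h + i).+1|)%N.
  apply: eq_bigr => i _; suff -> : (h.+1 - (h + i).+1 * k = 0)%N by rewrite muln1.
  have : ((h + i).+1 * 1 <= (h + i).+1 * k)%N by rewrite leq_mul2l ltnW ?orbT.
  by clear; lia.
rewrite tailE; apply: leq_ltn_trans (leq_add headG tail) _.
(* For [q >= 5] one has [2 G <= (5/2) q^h], so the total is at most [(9/2) q^h < q^(h+1)]. *)
have := sum_expS h q_gt0; rewrite -/G expnS.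
have : (0 < q ^ h)%N by rewrite expn_gt0 q_gt0.
by move: q_gt4; move: (q ^ h)%N (G); move: #|Fq|; clear; nia.
Qed.

Lemma exists_kfree (p : nat) : p \in [pchar Fq] -> ~~ (p %| k.+1)%N ->
  exists g : 'rV[Fq]_h.+1, kfree k (F + rVpoly g).
Proof.
move=> charFp pk1; apply: (exists_not_hit k_gt1 h_lt_n n_leq size_F).
apply: sum_hit_lt; have p_pr := pcharf_prime charFp.
have [pk|pk] := boolP (p %| k)%N; last first.
  apply: sum_hit_leq; rewrite -(dvdn_pcharf charFp) //.
  (* Characteristic 2 is excluded here, since one of [k] and [k + 1] is even. *)
  rewrite dvdn_prime2 //; apply: contraNneq pk1 => p2.
  by move: pk; rewrite p2 !dvdn2 oddS negbK.
have k0 : (0 < k)%N by apply: ltnW.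
(* [a] is the full power of [p] in [k], so the cofactor [j] is prime to [p]. *)
apply: (@sum_hit_pchar_leq k`_p k`_p^').
- by rewrite (eq_pnat _ (pcharf_eq charFp)) part_pnat.
- by rewrite -(dvdn_pcharf charFp) -p'natE // part_pnat.
- by rewrite mulnC partnC.
- by rewrite p_part_gt1 mem_primes p_pr k0.
Qed.

End ShortIntervals.

Theorem theorem1p4 (Fq : finFieldType) (k n : nat) (F : {poly Fq}) (h : int)
    (hchar : forall p : nat, p \in [pchar Fq] -> ~~ (p %| k + 1)%N)
    (hn : (k + 1 <= n)%N)
    (hmonic : F \is monic)
    (hdeg : size F = n.+1)
    (hh : n%:R / (k + 2)%:R <= h%:~R :> rat) :
  ((2 <= k)%N -> (7 <= #|Fq|)%N ->
     exists Q : {poly Fq}, Q \in interval_q F h /\ kfree k Q) /\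
  ((3 <= k)%N -> (5 <= #|Fq|)%N ->
     exists Q : {poly Fq}, Q \in interval_q F h /\ kfree k Q).
Proof.
have main : (1 < k)%N -> ((7 <= #|Fq|) || ((2 < k) && (5 <= #|Fq|)))%N ->
    exists Q : {poly Fq}, Q \in interval_q F h /\ kfree k Q.
  move=> k1 hq; case: h hh => [m|m] hh; last first.
    have : 0 <= (Negz m)%:~R :> rat by apply: le_trans hh; rewrite divr_ge0.
    by rewrite ler0z.
  have n_leq : (n <= (k + 2) * m)%N.
    move: hh; rewrite ler_pdivrMr ?ltr0n ?addn_gt0 ?orbT //.
    by rewrite -[m%:~R]/(m%:R) -natrM ler_nat mulnC.
  (* Counting needs [h < n], so that every element of the interval has degree [n]; for [h >= n] the
     interval contains 1. *)
  have [nm|mn] := leqP n m.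
    exists 1; split; last first.
      move=> P sP; rewrite dvdp1 (size_expE (d := (size P).-1)) ?prednK //.
        by rewrite eqSS muln_eq0 negb_or -!lt0n -subn1 subn_gt0 sP ltnW.
      exact: ltnW.
    rewrite inE /deg_le; apply/orP; right; rewrite lez_nat.
    have : (size (F - 1)%R <= n.+1)%N.
      apply: leq_trans (size_polyD _ _) _.
      by rewrite size_polyN size_poly1 hdeg geq_max leqnn.
    by move: (size _) => s; lia.
  have [p p_pr charFp] := finPcharP Fq.
  have [|g gfree] := exists_kfree k1 mn n_leq hdeg hq charFp.
    by rewrite -addn1 hchar.
  exists (F + rVpoly g); split=> //.
  rewrite inE /deg_le; apply/orP; right; rewrite lez_nat.
  have -> : F - (F + rVpoly g) = - rVpoly g by ring.
  rewrite size_polyN; have : (size (rVpoly g) <= m.+1)%N by apply: size_poly.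
  by move: (size _); clear; lia.
split=> hk hq; apply: main; rewrite ?hk ?hq ?orbT //.
exact: ltnW.
Qed.
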